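(* There is a universal constant $C>0$ such that the following holds. For every tabular and episodic MDP with deterministic expert policy $\pi^{E}$ and every $\varepsilon\in(0,H]$, if the number $m$ of expert trajectories satisfies $m\ge C\,|\mathcal S|H^2/\varepsilon^2$, then any VAIL solution $\pi^{\mathrm{AIL}}$, i.e. any minimizer over $\pi\in\Pi$ of $$\sum_{h=1}^{H}\sum_{(s,a)\in\mathcal S\times\mathcal A}\bigl|P^{\pi}_h(s,a)-\widehat P^{\pi^{E}}_h(s,a)\bigr|,$$ satisfies $V^{\pi^{E}}-\mathbb E[V^{\pi^{\mathrm{AIL}}}]\le\varepsilon$, where the expectation is over the random expert dataset. (That is, VAIL requires at most $O(|\mathcal S|H^2/\varepsilon^2)$ expert trajectories in expectation.)
   Context: A tabular episodic MDP is a tuple $(\mathcal S,\mathcal A,P,r,H,\rho)$ with finite state space $\mathcal S$ and action space $\mathcal A$, horizon $H$, time-dependent transitions $P_h(s'|s,a)$, rewards $r_h:\mathcal S\times\mathcal A\to[0,1]$ ($h=1,\dots,H$), and initial state distribution $\rho$. A policy is $\pi=(\pi_1,\dots,\pi_H)$ with $\pi_h:\mathcal S\to\Delta(\mathcal A)$; $\Pi$ is the set of all such (stochastic, non-stationary) policies. $V^\pi=\mathbb E[\sum_{h=1}^H r_h(s_h,a_h)]$ with $s_1\sim\rho$, $a_h\sim\pi_h(\cdot|s_h)$, $s_{h+1}\sim P_h(\cdot|s_h,a_h)$, and $P^\pi_h(s,a)$ is the probability that $(s_h,a_h)=(s,a)$ under $\pi$. The expert policy $\pi^{E}$ is deterministic.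 The dataset $\mathcal D$ consists of $m=|\mathcal D|$ i.i.d. length-$H$ trajectories generated by $\pi^{E}$ in the MDP, and $\widehat P^{\pi^{E}}_h(s,a)$ is the fraction of trajectories in $\mathcal D$ with $(s_h,a_h)=(s,a)$. The transition function and initial distribution are known to the learner. *)

(* Defs.v *)
From mathcomp Require Import all_boot all_order all_algebra.
From mathcomp Require Import reals.

Set Implicit Arguments.
Unset Strict Implicit.
Unset Printing Implicit Defensive.

Import Order.TTheory GRing.Theory Num.Theory.

Local Open Scope ring_scope.

Record dist (R : realType) (T : finType) := Dist {
  pmf :> T -> R;
  pmf_ge0 : forall x, 0 <= pmf x;
  pmf_sum1 : \sum_x pmf x = 1 }.

(* Stages h = 1, ..., H are indexed by 'I_H, hence shifted to 0, ..., H - 1.  *)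
(* The kernel at the last stage is part of the data but is never used.        *)
Record mdp (R : realType) (S A : finType) (H : nat) := MDP {
  trans : 'I_H -> S -> A -> dist R S;
  reward : 'I_H -> S -> A -> R;
  init : dist R S;
  reward_bound : forall h s a, 0 <= reward h s a <= 1 }.

Definition policy (R : realType) (S A : finType) (H : nat) :=
  'I_H -> S -> dist R A.

Definition deterministic (R : realType) (S A : finType) (H : nat)
    (pi : policy R S A H) : Prop :=
  forall h s, exists a, pi h s a = 1.

Definition traj (S A : finType) (H : nat) := {ffun 'I_H -> S * A}.

(* Joint law of (s_1, a_1, ..., s_H, a_H):                                    *)
(*   rho(s_1) * prod_(h <= H) pi_h(a_h | s_h)                                 *)
(*            * prod_(h < H) P_h(s_(h+1) | s_h, a_h).                         *)
(* The conditions h == 0 and h' == h.+1 select at most one index each.        *)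
Definition traj_law (R : realType) (S A : finType) (H : nat)
    (M : mdp R S A H) (pi : policy R S A H) (tau : traj S A H) : R :=
  (\prod_(h < H | h == 0%N :> nat) init M (tau h).1) *
  (\prod_(h < H) pi h (tau h).1 (tau h).2) *
  (\prod_(h < H) \prod_(h' < H | h' == h.+1 :> nat)
      trans M h (tau h).1 (tau h).2 (tau h').1).

Definition value (R : realType) (S A : finType) (H : nat)
    (M : mdp R S A H) (pi : policy R S A H) : R :=
  \sum_(tau : traj S A H)
    traj_law M pi tau * \sum_(h < H) reward M h (tau h).1 (tau h).2.

Definition occupancy (R : realType) (S A : finType) (H : nat)
    (M : mdp R S A H) (pi : policy R S A H) (h : 'I_H) (s : S) (a : A) : R :=
  \sum_(tau : traj S A H | tau h == (s, a)) traj_law M pi tau.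

Definition dataset (S A : finType) (H m : nat) := {ffun 'I_m -> traj S A H}.

(* Expectation of f over m i.i.d. trajectories generated by pi in M. *)
Definition dataset_expectation (R : realType) (S A : finType) (H m : nat)
    (M : mdp R S A H) (pi : policy R S A H) (f : dataset S A H m -> R) : R :=
  \sum_(D : dataset S A H m) (\prod_(i < m) traj_law M pi (D i)) * f D.

Definition empirical (R : realType) (S A : finType) (H m : nat)
    (D : dataset S A H m) (h : 'I_H) (s : S) (a : A) : R :=
  #|[set i : 'I_m | D i h == (s, a)]|%:R / m%:R.

Definition vail_loss (R : realType) (S A : finType) (H m : nat)
    (M : mdp R S A H) (D : dataset S A H m) (pi : policy R S A H) : R :=
  \sum_(h < H) \sum_(sa : S * A)
    `|occupancy M pi h sa.1 sa.2 - empirical R D h sa.1 sa.2|.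

Definition vail_solution (R : realType) (S A : finType) (H m : nat)
    (M : mdp R S A H) (D : dataset S A H m) (pi : policy R S A H) : Prop :=
  forall pi' : policy R S A H, vail_loss M D pi <= vail_loss M D pi'.

(* Main.v *)
(** Rewards lie in [0, 1], so values differ by at most the l1 distance of the
    occupancies. Comparing the minimiser with the expert through the empirical
    occupancy, the triangle inequality bounds the regret on a dataset by twice
    the expert's own loss. The empirical frequency of (s, a) at stage h has
    variance at most P_h(s, a) / m, which vanishes unless a is the expert's
    action at s: only |S| pairs per stage contribute. Summing
    |x| <= x^2 / (2 t) + t / 2 over them with t = eps / (2 H |S|) bounds the
    expected regret by 2 H^2 |S| / (eps m) + eps / 2, so that C = 4 works. *)

Require Import Defs.
From mathcomp Require Import all_boot all_order all_algebra.
From mathcomp Require Import reals.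
From mathcomp Require Import ring.

Set Implicit Arguments.
Unset Strict Implicit.
Unset Printing Implicit Defensive.

Import Order.TTheory GRing.Theory Num.Theory.

Local Open Scope ring_scope.

(** * Path laws of finite Markov chains *)

Section FinfunCons.
Variables (X : finType) (n : nat).

Definition fcons (x : X) (t : {ffun 'I_n -> X}) : {ffun 'I_n.+1 -> X} :=
  [ffun i => if unlift ord0 i is Some j then t j else x].

Lemma fcons0 x t : fcons x t ord0 = x.
Proof. by rewrite ffunE unlift_none. Qed.

Lemma fconsS x t j : fcons x t (lift ord0 j) = t j.
Proof. by rewrite ffunE liftK. Qed.

Lemma sum_fcons (V : nmodType) (F : {ffun 'I_n.+1 -> X} -> V) :
  \sum_tau F tau = \sum_x \sum_t F (fcons x t).
Proof.
rewrite pair_big /= (reindex (fun p : X * {ffun 'I_n -> X} => fcons p.1 p.2)) //=.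
exists (fun tau : {ffun 'I_n.+1 -> X} =>
          (tau ord0, [ffun j => tau (lift ord0 j)])) => [[x t] _|tau _] /=.
  by rewrite fcons0; congr pair; apply/ffunP => j; rewrite ffunE fconsS.
apply/ffunP => i; case: (unliftP ord0 i) => [j ->|->]; last by rewrite fcons0.
by rewrite fconsS ffunE.
Qed.

End FinfunCons.

(** Induction on the number of steps: summing out the first state leaves a chain with one step
    fewer, started from the law of the second state. *)
Lemma markov_chain_sum1 (R : comNzRingType) (X : finType) (n : nat)
    (p : X -> R) (K : 'I_n -> X -> X -> R) :
  \sum_x p x = 1 -> (forall i x, \sum_y K i x y = 1) ->
  \sum_(tau : {ffun 'I_n.+1 -> X}) p (tau ord0) *
    \prod_(i < n) K i (tau (widen_ord (leqnSn n) i)) (tau (lift ord0 i)) = 1.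
Proof.
elim: n p K => [|n IHn] p K p1 K1.
  rewrite sum_fcons -[RHS]p1; apply: eq_bigr => x _.
  under eq_bigr do rewrite big_ord0 mulr1 fcons0.
  by rewrite sumr_const card_ffun card_ord expn0.
have wid (i : 'I_n) : widen_ord (leqnSn n.+1) (lift ord0 i)
    = lift ord0 (widen_ord (leqnSn n) i) by apply: val_inj.
rewrite sum_fcons exchange_big /=.
rewrite -[RHS](IHn (fun y => \sum_x p x * K ord0 x y)
  (fun i => K (lift ord0 i))) //; last first.
  rewrite exchange_big /= -p1; apply: eq_bigr => x _.
  by rewrite -mulr_sumr K1 mulr1.
apply: eq_bigr => t _; rewrite mulr_suml; apply: eq_bigr => x _.
have w0 : widen_ord (leqnSn n.+1) ord0 = ord0 by apply: val_inj.
rewrite big_ord_recl w0 !fcons0 fconsS mulrA; congr (_ * _).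
by apply: eq_bigr => i _; rewrite wid !fconsS.
Qed.

(** * Moments of functions of an i.i.d. sample *)

Section Iid.
Variables (R : realFieldType) (X : finType) (mu : X -> R) (m : nat).
Hypothesis mu_ge0 : forall x, 0 <= mu x.
Hypothesis mu_sum1 : \sum_x mu x = 1.

Definition iid_mean (f : {ffun 'I_m -> X} -> R) : R :=
  \sum_(D : {ffun 'I_m -> X}) (\prod_(i < m) mu (D i)) * f D.

(** Independence, in the form of distributivity of products over sums. The means below reduce to it
    by padding with factors equal to 1. *)
Lemma iid_mean_prod (g : 'I_m -> X -> R) :
  iid_mean (fun D => \prod_i g i (D i)) = \prod_i \sum_x mu x * g i x.
Proof.
rewrite bigA_distr_bigA /iid_mean; apply: eq_bigr => D _.
by rewrite -big_split.
Qed.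

Lemma eq_iid_mean f g : f =1 g -> iid_mean f = iid_mean g.
Proof. by move=> fg; apply: eq_bigr => D _; rewrite fg. Qed.

Lemma iid_mean_sum (I : finType) (f : I -> {ffun 'I_m -> X} -> R) :
  iid_mean (fun D => \sum_i f i D) = \sum_i iid_mean (f i).
Proof. by rewrite exchange_big; apply: eq_bigr => D _; rewrite mulr_sumr. Qed.

Lemma iid_meanZ c f : iid_mean (fun D => c * f D) = c * iid_mean f.
Proof. by rewrite mulr_sumr; apply: eq_bigr => D _; rewrite mulrCA. Qed.

Lemma iid_meanD f g : iid_mean (fun D => f D + g D) = iid_mean f + iid_mean g.
Proof. by rewrite -big_split; apply: eq_bigr => D _; rewrite mulrDr. Qed.

Lemma iid_mean_cst c : iid_mean (fun=> c) = c.
Proof.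
transitivity (c * iid_mean (fun D => \prod_(i < m) 1)).
  by rewrite -iid_meanZ; apply: eq_iid_mean => D; rewrite big1 ?mulr1.
rewrite (iid_mean_prod (fun _ _ => 1)) big1 ?mulr1 // => i _.
by under eq_bigr do rewrite mulr1.
Qed.

Lemma le_iid_mean f g : (forall D, f D <= g D) -> iid_mean f <= iid_mean g.
Proof.
by move=> fg; apply: ler_sum => D _; rewrite ler_wpM2l // prodr_ge0.
Qed.

Lemma iid_mean_coord (g : X -> R) i :
  iid_mean (fun D => g (D i)) = \sum_x mu x * g x.
Proof.
transitivity (iid_mean (fun D => \prod_j (if j == i then g (D j) else 1))).
  by apply: eq_iid_mean => D; rewrite -big_mkcond big_pred1_eq.
rewrite (iid_mean_prod (fun j x => if j == i then g x else 1)) (bigD1 i) //=.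
rewrite eqxx [X in _ * X]big1 ?mulr1 // => j /negPf ->.
by under eq_bigr do rewrite mulr1.
Qed.

(** As [i] and [j] differ, coordinate [i] contributes the factor [\sum_x mu x * g x], which is 0. *)
Lemma iid_mean_cross (g : X -> R) i j :
  \sum_x mu x * g x = 0 -> i != j -> iid_mean (fun D => g (D i) * g (D j)) = 0.
Proof.
move=> g0 ij.
transitivity (iid_mean (fun D => \prod_k
    ((if k == i then g (D k) else 1) * (if k == j then g (D k) else 1)))).
  apply: eq_iid_mean => D.
  by rewrite big_split /= -!big_mkcond !big_pred1_eq.
rewrite (iid_mean_prod (fun k x =>
  (if k == i then g x else 1) * (if k == j then g x else 1))) (bigD1 i) //=.
rewrite eqxx (negPf ij); under eq_bigr do rewrite mulr1.
by rewrite g0 mul0r.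
Qed.

Lemma iid_mean_sqr_sum (g : X -> R) :
  \sum_x mu x * g x = 0 ->
  iid_mean (fun D => (\sum_i g (D i)) ^+ 2) = m%:R * \sum_x mu x * g x ^+ 2.
Proof.
move=> g0.
transitivity (\sum_i \sum_j iid_mean (fun D => g (D i) * g (D j))).
  rewrite -(eq_bigr _ (fun i _ => iid_mean_sum _)) -iid_mean_sum.
  apply: eq_iid_mean => D; rewrite expr2 mulr_suml.
  by apply: eq_bigr => i _; rewrite mulr_sumr.
rewrite mulr_natl -[m in RHS]card_ord -sumr_const; apply: eq_bigr => i _.
rewrite (bigD1 i) //= big1 ?addr0 => [|j ji]; last first.
  by rewrite iid_mean_cross // eq_sym.
by rewrite -(iid_mean_coord _ i); apply: eq_iid_mean.
Qed.

(** The exact value is [(p - p ^+ 2) / m%:R]. Dropping the square leaves a bound linear in [p],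
    which can be summed over disjoint events. *)
Lemma frequency_variance_le (E : pred X) : (0 < m)%N ->
  iid_mean (fun D => (\sum_(x | E x) mu x -
                      #|[set i | E (D i)]|%:R / m%:R) ^+ 2)
    <= (\sum_(x | E x) mu x) / m%:R.
Proof.
move=> m_gt0; set p := \sum_(x | E x) mu x.
have m0 : m%:R != 0 :> R by rewrite pnatr_eq0 -lt0n.
have pE : \sum_x mu x * (E x)%:R = p.
  by rewrite /p [RHS]big_mkcond; apply: eq_bigr => x _; case: (E x);
     rewrite ?mulr1 ?mulr0.
pose g x := (E x)%:R - p.
have g0 : \sum_x mu x * g x = 0.
  under eq_bigr do rewrite mulrBr.
  by rewrite sumrB pE -mulr_suml mu_sum1 mul1r subrr.
have g2 : \sum_x mu x * g x ^+ 2 = p - p ^+ 2.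
  (* The square of the centred indicator is expanded; an indicator equals its own square. *)
  transitivity (\sum_x (mu x * (E x)%:R + (mu x * (E x)%:R) * (- 2 * p)
                        + mu x * p ^+ 2)).
    by apply: eq_bigr => x _; rewrite /g; case: (E x) => /=; ring.
  by rewrite !big_split /= -!mulr_suml pE mu_sum1; ring.
have -> : iid_mean (fun D => (p - #|[set i | E (D i)]|%:R / m%:R) ^+ 2)
    = (m%:R ^- 2) * iid_mean (fun D => (\sum_i g (D i)) ^+ 2).
  rewrite -iid_meanZ; apply: eq_iid_mean => D.
  have -> : #|[set i | E (D i)]|%:R = \sum_i (E (D i))%:R :> R.
    rewrite -sum1dep_card natr_sum [LHS]big_mkcond; apply: eq_bigr => i _.
    by case: (E _).
  by rewrite /g sumrB sumr_const card_ord -mulr_natl; field.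
rewrite iid_mean_sqr_sum // g2.
have -> : m%:R ^- 2 * (m%:R * (p - p ^+ 2)) = (p - p ^+ 2) / m%:R :> R.
  by field.
by rewrite ler_pM2r ?invr_gt0 ?ltr0n // gerBl sqr_ge0.
Qed.

(** The pointwise gap is [(x - t) ^+ 2 / (2 * t)] with [x] the absolute value. This linearised form
    of Cauchy-Schwarz involves no square root and leaves [t] to be tuned. *)
Lemma iid_mean_abs_le (f : {ffun 'I_m -> X} -> R) t : 0 < t ->
  iid_mean (fun D => `|f D|) <= iid_mean (fun D => f D ^+ 2) / (2 * t) + t / 2.
Proof.
move=> t0; rewrite mulrC -iid_meanZ -[t / 2]iid_mean_cst -iid_meanD.
apply: le_iid_mean => D; rewrite -[f D ^+ 2]real_normK ?num_real //.
set x := `|f D|.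
have -> : (2 * t)^-1 * x ^+ 2 + t / 2 = x + (x - t) ^+ 2 / (2 * t).
  by field; rewrite gt_eqF.
by rewrite lerDl divr_ge0 ?sqr_ge0 ?mulr_ge0 ?ltW.
Qed.

(** The previous bound with [t] tending to 0; taking [t = 2 * e] leaves exactly [e]. *)
Lemma iid_mean_abs_eq0 (f : {ffun 'I_m -> X} -> R) :
  iid_mean (fun D => f D ^+ 2) <= 0 -> iid_mean (fun D => `|f D|) <= 0.
Proof.
move=> f2; apply/ler_addgt0Pl => e e0; rewrite addr0.
have e20 : 0 < 2 * e by rewrite mulr_gt0.
apply: le_trans (iid_mean_abs_le f e20) _.
have -> : 2 * e / 2 = e by field.
by rewrite gerDr mulr_le0_ge0 // invr_ge0 ltW // mulr_gt0.
Qed.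

End Iid.

(** * Occupancies, values and the regret of a minimiser *)

Section Episodic.
Variables (R : realType) (S A : finType) (H : nat) (M : mdp R S A H).
Implicit Type pi : policy R S A H.

Lemma traj_law_ge0 pi tau : 0 <= traj_law M pi tau.
Proof.
rewrite /traj_law !mulr_ge0 // prodr_ge0 // => h _; try exact: pmf_ge0.
by apply: prodr_ge0 => h' _; exact: pmf_ge0.
Qed.

Lemma occupancy_eq0 pi h s a : pi h s a = 0 -> occupancy M pi h s a = 0.
Proof.
move=> pi0; apply: big1 => tau /eqP tauh.
by rewrite /traj_law [X in _ * X * _](bigD1 h) //= tauh pi0 !(mul0r, mulr0).
Qed.

(** The occupancy at stage [h] is the image of the trajectory law under [tau h], so trajectories are
    grouped by that value. *)
Lemma sum_traj_occupancy pi h (F : S * A -> R) :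
  \sum_tau traj_law M pi tau * F (tau h)
    = \sum_sa occupancy M pi h sa.1 sa.2 * F sa.
Proof.
rewrite (partition_big (fun tau : traj S A H => tau h) predT) //=.
apply: eq_bigr => -[s a] _; rewrite mulr_suml.
by apply: eq_bigr => tau /eqP ->.
Qed.

Lemma value_occupancy pi :
  value M pi = \sum_h \sum_sa occupancy M pi h sa.1 sa.2 *
                              reward M h sa.1 sa.2.
Proof.
rewrite /value; under eq_bigr do rewrite mulr_sumr.
rewrite exchange_big; apply: eq_bigr => h _.
by rewrite -(sum_traj_occupancy pi h (fun sa => reward M h sa.1 sa.2)).
Qed.

Lemma value_sub_le pi pi' :
  value M pi - value M pi' <= \sum_h \sum_sa
    `|occupancy M pi h sa.1 sa.2 - occupancy M pi' h sa.1 sa.2|.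
Proof.
rewrite !value_occupancy -sumrB; apply: ler_sum => h _.
rewrite -sumrB; apply: ler_sum => -[s a] _ /=; rewrite -mulrBl.
have /andP[r0 r1] := reward_bound M h s a.
apply: le_trans (ler_norm _) _.
by rewrite normrM (ger0_norm r0) ler_piMr.
Qed.

Lemma vail_regret_le m (D : dataset S A H m) pi piE :
  vail_solution M D pi -> value M piE - value M pi <= 2 * vail_loss M D piE.
Proof.
move=> solpi; apply: le_trans (value_sub_le _ _) _.
rewrite mulr_natl mulr2n.
apply: le_trans (_ : vail_loss M D piE + vail_loss M D pi <= _); last first.
  (* After cancellation, this is the minimality of [pi] tested against [piE]. *)
  by rewrite lerD2l.
rewrite -big_split; apply: ler_sum => h _; rewrite -big_split.
apply: ler_sum => sa _ /=; rewrite [X in _ <= _ + X]distrC.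
exact: ler_distD.
Qed.

End Episodic.

(** State-action pairs form a Markov chain: the initial law is the product of [init] and the first
    policy stage, and each kernel is a transition followed by the next policy stage. *)
Lemma traj_law_sum1 (R : realType) (S A : finType) (n : nat)
    (M : mdp R S A n.+1) (pi : policy R S A n.+1) :
  \sum_tau traj_law M pi tau = 1.
Proof.
pose p (x : S * A) := init M x.1 * pi ord0 x.1 x.2.
pose K (i : 'I_n) (x y : S * A) :=
  trans M (widen_ord (leqnSn n) i) x.1 x.2 y.1 * pi (lift ord0 i) y.1 y.2.
have sum_pair (q : dist R S) (h : 'I_n.+1) :
    \sum_(y : S * A) q y.1 * pi h y.1 y.2 = 1.
  rewrite -(pair_big xpredT xpredT (fun s a => q s * pi h s a)) /= -(pmf_sum1 q).
  by apply: eq_bigr => s _; rewrite -mulr_sumr pmf_sum1 mulr1.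
rewrite -[RHS](@markov_chain_sum1 _ _ _ p K); last 2 first.
- exact: sum_pair.
- by move=> i x; exact: sum_pair.
apply: eq_bigr => tau _; rewrite /traj_law /p /K.
rewrite (big_pred1 ord0) // big_split /=.
rewrite [X in _ * X * _]big_ord_recl [X in _ * X = _]big_ord_recr /=.
(* The last stage has no successor, so its inner product is empty. *)
rewrite [X in _ * (_ * X) = _]big1 => [|h' /eqP h'n]; last first.
  by have := ltn_ord h'; rewrite h'n ltnn.
rewrite mulr1 -!mulrA; congr (_ * (_ * _)); rewrite mulrC; congr (_ * _).
by apply: eq_bigr => i _; rewrite (big_pred1 (lift ord0 i)).
Qed.

(** In each state only the expert's action costs anything: a variance term proportional to its
    occupancy, plus [t / 2]. The occupancies add up to 1, and [t / 2] is paid once per state. *)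
Lemma stage_loss_le (R : realType) (S A : finType) (n m : nat)
    (M : mdp R S A n.+1) (piE : policy R S A n.+1) (h : 'I_n.+1) (t : R) :
  (0 < m)%N -> deterministic piE -> 0 < t ->
  \sum_(sa : S * A) dataset_expectation M piE (fun D : dataset S A n.+1 m =>
      `|occupancy M piE h sa.1 sa.2 - empirical R D h sa.1 sa.2|)
    <= (m%:R * (2 * t))^-1 + #|S|%:R * (t / 2).
Proof.
move=> m0 detE t0.
have mu0 := traj_law_ge0 M piE; have mu1 := traj_law_sum1 M piE.
set c := (m%:R * (2 * t))^-1.
have var s a : dataset_expectation M piE (fun D : dataset S A n.+1 m =>
    (occupancy M piE h s a - empirical R D h s a) ^+ 2)
    <= occupancy M piE h s a / m%:R.
  exact: (frequency_variance_le mu1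
    (fun tau : traj S A n.+1 => tau h == (s, a)) m0).
have occ1 : \sum_s \sum_a occupancy M piE h s a = 1.
  rewrite pair_big /= -mu1; under [RHS]eq_bigr do rewrite -[traj_law _ _ _]mulr1.
  by rewrite (sum_traj_occupancy M piE h (fun=> 1)); apply: eq_bigr => sa _; rewrite mulr1.
have -> : c + #|S|%:R * (t / 2)
    = \sum_s (c * \sum_a occupancy M piE h s a + t / 2).
  by rewrite big_split /= -mulr_sumr occ1 mulr1 sumr_const mulr_natl.
rewrite -(pair_big xpredT xpredT (fun s a => dataset_expectation M piE
  (fun D : dataset S A n.+1 m => `|occupancy M piE h s a - empirical R D h s a|))) /=.
apply: ler_sum => s _; have [a0 pia0] := detE h s.
have occ0 a : a != a0 -> occupancy M piE h s a = 0.
  move=> aa0; apply: occupancy_eq0.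
  (* The action [a0] takes all the mass, so the other nonnegative probabilities sum to 0. *)
  have := pmf_sum1 (piE h s); rewrite (bigD1 a0) //= pia0.
  rewrite -[RHS]addr0 => /addrI rest0.
  by apply: (psumr_eq0P _ rest0) => // b _; exact: pmf_ge0.
rewrite (bigD1 a0) //= [X in c * X](bigD1 a0) //= [X in c * (_ + X)]big1 //.
rewrite addr0 -[leRHS]addr0; apply: lerD.
  apply: le_trans (iid_mean_abs_le mu0 mu1 _ t0) _.
  rewrite lerD2r /c [leRHS]mulrC [(m%:R * _)^-1]invfM mulrA.
  by rewrite ler_pM2r ?invr_gt0 ?mulr_gt0 //; exact: var.
(* Using the bound with [t] here would cost [t / 2] per action and bring in a factor [#|A|]; a zero
   second moment costs nothing. *)
apply: sumr_le0 => a aa0; apply: (iid_mean_abs_eq0 mu0 mu1).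
by apply: le_trans (var s a) _; rewrite occ0 // mul0r.
Qed.

Theorem theorem1 (R : realType) :
  exists2 C : R, 0 < C &
    forall (S A : finType) (H : nat) (M : mdp R S A H) (piE : policy R S A H),
      deterministic piE ->
    forall eps : R, 0 < eps -> eps <= H%:R ->
    forall m : nat, C * #|S|%:R * H%:R ^+ 2 / eps ^+ 2 <= m%:R ->
    forall piAIL : dataset S A H m -> policy R S A H,
      (forall D, vail_solution M D (piAIL D)) ->
      value M piE - dataset_expectation M piE (fun D => value M (piAIL D))
        <= eps.
Proof.
exists 4 => // S A [|n] M piE detE eps eps0 epsH m mC piAIL sol.
  (* Horizon 0 would force [0 < eps <= 0]. *)
  by have := lt_le_trans eps0 epsH; rewrite ltxx.
(* An empty state space carries no initial distribution. *)
have S0 : 0 < #|S|%:R :> R.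
  rewrite ltr0n lt0n; apply/eqP => /card0_eq S0.
  have := pmf_sum1 (init M); rewrite big1 => [/eqP|s _]; last first.
    by have := S0 s; rewrite inE.
  by rewrite eq_sym oner_eq0.
have H0 : 0 < n.+1%:R :> R by rewrite ltr0n.
have m0 : 0 < m%:R :> R.
  by apply: lt_le_trans mC; rewrite !(mulr_gt0, invr_gt0, exprn_gt0).
have mu0 := traj_law_ge0 M piE; have mu1 := traj_law_sum1 M piE.
(* The expert's value is constant in the dataset, so it moves under the expectation. *)
have -> : value M piE - dataset_expectation M piE (fun D => value M (piAIL D))
    = dataset_expectation M piE (fun D => value M piE - value M (piAIL D)).
  rewrite -[value M piE in LHS](iid_mean_cst m mu1) -[- _]mulN1r.
  rewrite -[X in _ + X](iid_meanZ (traj_law M piE)) -iid_meanD.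
  by apply: eq_iid_mean => D; rewrite mulN1r.
apply: le_trans (_ : dataset_expectation M piE
    (fun D => 2 * vail_loss M D piE) <= _).
  by apply: (le_iid_mean mu0) => D; exact: vail_regret_le.
rewrite [leLHS](iid_meanZ (traj_law M piE)).
(* Chosen so that the [t / 2] terms, summed over states and stages and doubled, give exactly
   [eps / 2]. *)
pose t : R := eps / (2 * n.+1%:R * #|S|%:R).
have t0 : 0 < t by rewrite divr_gt0 // !mulr_gt0.
have lossE : iid_mean (traj_law M piE) (fun D : dataset S A n.+1 m => vail_loss M D piE)
    <= n.+1%:R * ((m%:R * (2 * t))^-1 + #|S|%:R * (t / 2)).
  rewrite /vail_loss iid_mean_sum mulr_natl -[n.+1 in leRHS]card_ord -sumr_const.
  apply: ler_sum => h _; rewrite iid_mean_sum.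
  by apply: stage_loss_le => //; rewrite -(ltr0n R).
apply: le_trans (_ : 2 * (n.+1%:R * ((m%:R * (2 * t))^-1 + #|S|%:R * (t / 2))) <= _).
  by rewrite ler_pM2l.
(* The variance part is [eps / 2] times the ratio of the required sample size to [m], which is at
   most 1. *)
have -> : 2 * (n.+1%:R * ((m%:R * (2 * t))^-1 + #|S|%:R * (t / 2)))
    = (4 * #|S|%:R * n.+1%:R ^+ 2 / eps ^+ 2) / m%:R * (eps / 2) + eps / 2.
  by rewrite /t; field; rewrite nat1r !gt_eqF.
have : 4 * #|S|%:R * n.+1%:R ^+ 2 / eps ^+ 2 / m%:R <= 1.
  by rewrite ler_pdivrMr // mul1r.
move=> q1; apply: le_trans (_ : 1 * (eps / 2) + eps / 2 <= _).
  by rewrite lerD2r ler_pM2r // divr_gt0.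
by rewrite mul1r -splitr.
Qed.
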